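(* Lloyd's 15 Tile Puzzle is unsolvable: there is no finite sequence of legal moves that transforms Lloyd's starting configuration into the goal configuration.
   Context: The 15 tile puzzle is played on a $4\times 4$ grid whose positions are labelled $1,\dots,16$ row by row, from left to right and top to bottom. Fifteen of the cells carry tiles labelled $1,\dots,15$, each used once, and the remaining cell is empty; the empty cell is regarded as carrying the ''empty tile'' $16$. A configuration is a bijection $C:\{1,\dots,16\}\to\{1,\dots,16\}$ sending each position to the label of the tile there. A legal move slides a tile that is horizontally or vertically adjacent to the empty cell into the empty cell, so that the empty cell moves to the former location of that tile; equivalently, it exchanges the empty tile $16$ with a tile in a horizontally or vertically adjacent cell. The goal configuration is the one with tile $i$ in position $i$ for $1\le i\le 15$ and the empty cell in position $16$ (the bottom right corner). Lloyd's starting configuration is the same as the goal configuration except that tiles $14$ and $15$ are interchanged: position $14$ carries tile $15$, position $15$ carries tile $14$, tile $i$ is in position $i$ for $1\le i\le 13$, and the empty cell is in position $16$. *)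

(* Defs.v *)
From mathcomp Require Import all_boot all_fingroup.

Set Implicit Arguments.
Unset Strict Implicit.
Unset Printing Implicit Defensive.

(* Positions and tile labels 1, ..., 16 are both encoded by 'I_16, the
   number k being represented by the ordinal of value k - 1. *)
Definition num (k : nat) : 'I_16 := inord k.-1.

Definition empty_tile : 'I_16 := num 16.

(* C p is the label of the tile in position p. *)
Definition configuration := {perm 'I_16}.

Definition row_of (p : 'I_16) : nat := p %/ 4.
Definition col_of (p : 'I_16) : nat := p %% 4.

Definition consecutive (m n : nat) : bool := (m == n.+1) || (n == m.+1).

Definition adjacent (p q : 'I_16) : bool :=
  ((row_of p == row_of q) && consecutive (col_of p) (col_of q))
  || ((col_of p == col_of q) && consecutive (row_of p) (row_of q)).

(* The empty tile in p is exchanged with the tile in an adjacent cell q; all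
   other cells are unchanged, since (tperm p q * C) r = C (tperm p q r). *)
Definition legal_move (C D : configuration) : bool :=
  [exists p, exists q,
    [&& C p == empty_tile, adjacent p q & D == (tperm p q * C)%g]].

Definition goal : configuration := 1%g.

Definition lloyd : configuration := tperm (num 14) (num 15).

(* Main.v *)
Require Import Defs.
From mathcomp Require Import all_boot all_fingroup.

(** A legal move changes the sign of the configuration, being composition with
    a transposition, and also the checkerboard colour of the empty cell. So sign
    plus colour is invariant, but the two configurations have opposite signs
    and the same empty cell. *)

Definition cell_colour (p : 'I_16) : bool := odd (row_of p + col_of p).

(** A configuration sends positions to labels, so its inverse at [empty_tile] locates the empty
    cell. *)
Definition parity (C : configuration) : bool :=
  odd_perm C (+) cell_colour ((C^-1)%g empty_tile).

Lemma odd_consecutive m n : consecutive m n -> odd n = ~~ odd m.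
Proof. by case/orP=> /eqP-> /=; rewrite ?negbK. Qed.

Lemma adjacent_colour p q : adjacent p q -> cell_colour q = ~~ cell_colour p.
Proof.
rewrite /cell_colour !oddD.
by case/orP=> /andP[/eqP-> /odd_consecutive->]; rewrite ?addbN ?addNb.
Qed.

Lemma adjacent_neq p q : adjacent p q -> p != q.
Proof.
move=> /adjacent_colour pq; apply/eqP=> eq_pq.
by move: pq; rewrite eq_pq; case: cell_colour.
Qed.

Lemma parity_legal_move C D : legal_move C D -> parity D = parity C.
Proof.
case/existsP=> p /existsP[q /and3P[/eqP Cp pq /eqP->]].
rewrite /parity odd_mul_tperm (adjacent_neq _ _ pq) invMg tpermV permM.
(* The inverse of the new configuration is [C^-1] followed by [tperm p q]: it sends the empty tile
   to [p], then to [q]. Both summands flip, and the flips cancel. *)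
rewrite -Cp permK tpermL (adjacent_colour _ _ pq).
by rewrite addTb addNb addbN negbK.
Qed.

Lemma parity_path C moves :
  path legal_move C moves -> parity (last C moves) = parity C.
Proof.
elim: moves C => //= D moves IH C /andP[CD /IH->].
exact: parity_legal_move.
Qed.

Lemma parity_lloyd : parity lloyd = ~~ parity goal.
Proof.
have num_neq i j : i < 16 -> j < 16 -> i != j -> num i.+1 != num j.+1.
  by move=> lti ltj; rewrite -val_eqE /= !inordK.
rewrite /parity odd_tperm odd_perm1 tpermV invg1 perm1 num_neq //.
(* The swap of 14 and 15 fixes 16, so the colour terms agree. *)
by rewrite tpermD ?num_neq.
Qed.

Theorem claim0p2 :
  ~ exists moves : seq configuration,
      path legal_move lloyd moves /\ last lloyd moves = goal.
Proof.
case=> moves [/parity_path inv end_goal]; move: inv.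
by rewrite end_goal parity_lloyd; case: parity.
Qed.
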